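(* If $G$ is a finite simple graph with $c(G)=1$ and $\mathrm{capt}(G)=t$, then $\pi^{c}(G)\le 2^{t}$. More generally, if $c(G)=k$ and $\mathrm{capt}_k(G)=t$, then $\pi^{c}(G)\le k2^{t}$.
   Context: In the classical cops and robbers game, cops are placed on vertices, then the robber chooses a vertex; in each turn each cop may move along an edge or stay (no cost), then the robber may move along an edge or stay; the cops win upon a cop occupying the robber's vertex. The cop number $c(G)$ is the minimum number of cops guaranteeing a win. If $c(G)=k$, the capture time $\mathrm{capt}_k(G)$ is the minimum over cop strategies (with $k$ cops) of the maximum over robber strategies of the number of cop turns until capture; $\mathrm{capt}(G)=\mathrm{capt}_1(G)$. In the cops and robbers pebbling game, cops are placed according to a configuration $C:V(G)\to\mathbb{Z}_{\ge0}$, then the robber chooses a starting vertex; in each turn the cops make pebbling steps (a pebbling step from a vertex $u$ with at least two cops to an adjacent vertex $v$ removes two cops from $u$ and adds one cop to $v$), then the robber moves to an adjacent vertex or stays; capture occurs when the robber occupies a vertex holding a cop. The cop pebbling number $\pi^{c}(G)$ is the minimum size $\sum_v C(v)$ of a configuration from which the cops can always capture the robber. *)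

(* Defs.v *)
From mathcomp Require Import all_boot.
From mathcomp Require Import boolp.

Set Implicit Arguments.
Unset Strict Implicit.
Unset Printing Implicit Defensive.

Section Pursuit.

Variables (T : finType) (e : rel T).

Definition stay_or_move : rel T := [rel u v | (u == v) || e u v].

(* [S] is the type of cop states, [turn c c'] says that the cops may pass from
   [c] to [c'] in one turn, and [occ c v] that some cop is on [v] in [c]. *)
Variables (S : Type) (turn : S -> S -> Prop) (occ : S -> T -> bool).

(* A cop strategy maps the list of robber positions seen so far to the next cop
   state; its value at [::] is the initial placement.  A robber strategy maps
   the list of cop states seen so far (initial placement included) to the next
   robber position; its value at [::] is never used.  A player's own past is
   determined by the strategy and by the opponent's past. *)
Definition cop_strategy (sigma : seq T -> S) : Prop :=
  forall h r, turn (sigma h) (sigma (rcons h r)).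

Definition robber_strategy (rho : seq S -> T) : Prop :=
  forall h c c', stay_or_move (rho (rcons h c)) (rho (rcons (rcons h c) c')).

Section Play.

Variables (sigma : seq T -> S) (rho : seq S -> T).

(* The first [n] cop states and robber positions, placements included. *)
Fixpoint play (n : nat) : seq S * seq T :=
  if n is n'.+1 then
    let: (cs, rs) := play n' in
    let cs' := rcons cs (sigma rs) in (cs', rcons rs (rho cs'))
  else ([::], [::]).

(* The cop state after [n] cop turns, and the robber's answer to it. *)
Definition cop_at (n : nat) : S := sigma (play n).2.
Definition robber_at (n : nat) : T := rho (rcons (play n).1 (cop_at n)).

(* A cop may reach the robber during the [n]-th cop turn, or the robber may
   place himself on, or move to, a vertex occupied by a cop. *)
Definition captured_at (n : nat) : bool :=
  ((0 < n) && occ (cop_at n) (robber_at n.-1)) || occ (cop_at n) (robber_at n).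

End Play.

Definition captures (sigma : seq T -> S) : Prop :=
  forall rho, robber_strategy rho -> exists n, captured_at sigma rho n.

Definition captures_within (t : nat) (sigma : seq T -> S) : Prop :=
  forall rho, robber_strategy rho ->
    exists2 n, n <= t & captured_at sigma rho n.

End Pursuit.

Section CopsAndRobbers.

Variables (T : finType) (e : rel T).

Definition cops_turn (k : nat) (p p' : {ffun 'I_k -> T}) : Prop :=
  forall i, stay_or_move e (p i) (p' i).

Definition cops_occ (k : nat) (p : {ffun 'I_k -> T}) (v : T) : bool :=
  [exists i, p i == v].

Definition cops_win (k : nat) : Prop :=
  exists2 sigma, cop_strategy (@cops_turn k) sigma
               & captures e (@cops_occ k) sigma.

Definition cops_win_within (k t : nat) : Prop :=
  exists2 sigma, cop_strategy (@cops_turn k) sigma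
               & captures_within e (@cops_occ k) t sigma.

Lemma cops_win_exists : exists k, `[< cops_win k >].
Proof.
exists #|T|; apply/asboolP; exists (fun=> [ffun i => enum_val i]).
  by move=> h r i; rewrite /stay_or_move /= eqxx.
move=> rho _; exists 0; rewrite /captured_at /=.
by apply/existsP; exists (enum_rank (robber_at (fun=> [ffun i => enum_val i]) rho 0));
  rewrite ffunE enum_rankK.
Qed.

Definition cop_number : nat := ex_minn cops_win_exists.

(* The relation capt_k(G) = t: minimizing over the cop strategies the worst
   case, over the robber strategies, of the number of cop turns yields t. *)
Definition capture_time (k t : nat) : Prop :=
  cops_win_within k t /\ forall t', cops_win_within k t' -> t <= t'.

End CopsAndRobbers.

Section CopPebbling.

Variables (T : finType) (e : rel T).

Definition config := {ffun T -> nat}.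

Definition config_size (C : config) : nat := \sum_v C v.

(* [m u v] is the number of pebbling steps from [u] to [v] during the turn.
   They are simultaneous: the cops used in the steps must be present at the
   beginning of the turn, so that a cop moves along at most one edge. *)
Definition pebbling_turn (C C' : config) : Prop :=
  exists m : T -> T -> nat,
    [/\ forall u v, 0 < m u v -> e u v,
        forall u, 2 * \sum_v m u v <= C u
      & forall u, C' u = C u - 2 * \sum_v m u v + \sum_v m v u].

Definition pebbling_occ (C : config) (v : T) : bool := 0 < C v.

Definition cops_win_from (C : config) : Prop :=
  exists sigma, [/\ sigma [::] = C, cop_strategy pebbling_turn sigma
                  & captures e pebbling_occ sigma].

Definition cops_win_with_size (n : nat) : Prop :=
  exists2 C, config_size C = n & cops_win_from C.

Lemma cops_win_with_size_exists : exists n, `[< cops_win_with_size n >].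
Proof.
exists (config_size [ffun=> 1]); apply/asboolP; exists [ffun=> 1] => //.
exists (fun=> [ffun=> 1]); split=> //.
  move=> h r; exists (fun _ _ => 0).
  by split=> // u; rewrite sum_nat_const muln0 ?muln0 // subn0 addn0.
by move=> rho _; exists 0; rewrite /captured_at /= /pebbling_occ ffunE.
Qed.

Definition cop_pebbling_number : nat := ex_minn cops_win_with_size_exists.

End CopPebbling.

(* Main.v *)
Require Import Defs.
From mathcomp Require Import all_boot.
From mathcomp Require Import boolp.

Set Implicit Arguments.
Unset Strict Implicit.
Unset Printing Implicit Defensive.

(** Each of the [k] cops is replaced by a stack of [2 ^ t] pebbling cops, which
    follows him.  A stack is halved whenever its cop moves along an edge, so
    that it is still nonempty after [t] turns, when the robber is captured. *)

Section Play.

Variables (T : finType) (S : Type).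

Lemma size_play1 (sigma : seq T -> S) rho n : size (play sigma rho n).1 = n.
Proof.
elim: n => //= n; case: (play _ _ n) => cs rs /= IHn.
by rewrite size_rcons IHn.
Qed.

Lemma playS (sigma : seq T -> S) rho n :
  play sigma rho n.+1 = (rcons (play sigma rho n).1 (cop_at sigma rho n),
                         rcons (play sigma rho n).2 (robber_at sigma rho n)).
Proof. by rewrite /robber_at /cop_at /=; case: (play _ _ n). Qed.

Lemma size_play2 (sigma : seq T -> S) rho n : size (play sigma rho n).2 = n.
Proof. by elim: n => // n IHn; rewrite playS size_rcons IHn. Qed.

Lemma robber_at_move (e : rel T) (sigma : seq T -> S) rho n :
  robber_strategy e rho ->
  stay_or_move e (robber_at sigma rho n) (robber_at sigma rho n.+1).
Proof. by move=> rhoP; rewrite {2}/robber_at playS; apply: rhoP. Qed.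

End Play.

Section Replay.

Variables (T : finType) (S S' : Type).
Variables (sigma : seq T -> S) (sigma' : seq T -> S') (rho' : seq S' -> T).

(* The robber ignores [sigma] and repeats his moves against [sigma']. *)
Definition replay (h : seq S) : T := robber_at sigma' rho' (size h).-1.

(** A history of [n.+1] cop states, placement included, is answered by position [n] of the recorded
    play, so consecutive answers are consecutive positions of a legal robber. *)
Lemma replay_strategy (e : rel T) :
  robber_strategy e rho' -> robber_strategy e replay.
Proof.
by move=> rhoP h c c'; rewrite /replay !size_rcons; apply: robber_at_move.
Qed.

Lemma robber_at_replay n : robber_at sigma replay n = robber_at sigma' rho' n.
Proof. by rewrite {1}/robber_at /replay size_rcons size_play1. Qed.

(** Both cop strategies are thus fed the same robber history, and their states can be compared turn
    by turn. *)
Lemma play_replay n : (play sigma replay n).2 = (play sigma' rho' n).2.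
Proof. by elim: n => // n IHn; rewrite !playS /= IHn robber_at_replay. Qed.

End Replay.

Section Stacks.

Variables (T : finType) (e : rel T) (k : nat).
Implicit Types (p : {ffun 'I_k -> T}) (w : 'I_k -> nat).

Definition stacks p w : config T := [ffun v => \sum_(i | p i == v) w i].

Lemma stacks_size p w : config_size (stacks p w) = \sum_i w i.
Proof.
rewrite (partition_big p predT) //=.
by apply: eq_bigr => v _; rewrite ffunE.
Qed.

Lemma stacks_occ p w v :
  (forall i, 0 < w i) -> cops_occ p v -> pebbling_occ (stacks p w) v.
Proof.
move=> w_gt0 /existsP[i pi_v].
by rewrite /pebbling_occ ffunE (bigD1 i) //= addn_gt0 w_gt0.
Qed.

Lemma pebbling_turn_refl (C : config T) : pebbling_turn e C C.
Proof.
by exists (fun _ _ => 0); split=> // u; rewrite big1 ?muln0 ?subn0 ?addn0.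
Qed.

(** Each stack whose cop changes vertex spends all its [2 * w' i] pebbles on [w' i] steps along the
    edge taken. Stacks sharing a vertex do not interfere, as their contributions add up. *)
Lemma stacks_turn p p' w w' :
    cops_turn e p p' ->
    (forall i, w i = if p i == p' i then w' i else 2 * w' i) ->
  pebbling_turn e (stacks p w) (stacks p' w').
Proof.
move=> turn_pp' wE.
(* The condition [u != v] discards the cops who stay, whose stacks make no step. *)
pose m u v := \sum_(i | [&& p i == u, p' i == v & u != v]) w' i.
have out u : \sum_v m u v = \sum_(i | (p i == u) && (p' i != u)) w' i.
  rewrite [RHS](partition_big p' predT) //=; apply: eq_bigr => v _.
  apply: eq_bigl => i; rewrite -andbA; congr (_ && _).
  by rewrite andbC; case: (p' i =P v) => [->|]; rewrite ?andbF // eq_sym.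
have inn u : \sum_v m v u = \sum_(i | (p' i == u) && (p i != u)) w' i.
  rewrite [RHS](partition_big p predT) //=; apply: eq_bigr => v _.
  apply: eq_bigl => i; rewrite andbC -!andbA; congr (_ && _).
  by case: (p i =P v) => [->|]; rewrite ?andbF ?andbT.
have leaving u : 2 * \sum_v m u v = \sum_(i | (p i == u) && (p' i != u)) w i.
  rewrite out big_distrr /=; apply: eq_bigr => i /andP[/eqP pi_u].
  by rewrite wE pi_u eq_sym => /negPf->.
(* Separating the pebbles that stay from those spent gives the bound on the steps and makes the
   truncated subtraction exact. *)
have splitC u : stacks p w u =
    \sum_(i | (p i == u) && (p' i == u)) w i + 2 * \sum_v m u v.
  by rewrite ffunE leaving (bigID (fun i => p' i == u)).
exists m; split=> [u v | u | u]; last 2 first.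
- by rewrite splitC leq_addl.
- rewrite splitC addnK inn ffunE (bigID (fun i => p i == u)) /=.
  congr (_ + _); apply: eq_big => [i|i /andP[/eqP p'i /eqP pi]].
    by rewrite andbC.
  by rewrite wE p'i pi eqxx.
(* Without an edge from [u] to [v], no cop can pass between these distinct vertices, so the sum is
   empty. *)
rewrite lt0n; apply: contraNT => not_euv; rewrite /m big1 // => i.
case/and3P=> /eqP pi_u /eqP p'i_v neq_uv.
by have := turn_pp' i; rewrite pi_u p'i_v /stay_or_move /= (negPf neq_uv) (negPf not_euv).
Qed.

End Stacks.

Section PebblingStrategy.

Variables (T : finType) (e : rel T) (k t : nat).
Variable sigma : seq T -> {ffun 'I_k -> T}.
Hypothesis sigmaP : cop_strategy (@cops_turn T e k) sigma.

(** Comparing [sigma] on successive prefixes makes the count of edges travelled a function of the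
    robber history alone, as a strategy must be. *)
Definition moves (h : seq T) (i : 'I_k) : nat :=
  \sum_(j < size h) (sigma (take j h) i != sigma (take j.+1 h) i).

Lemma moves_le h i : moves h i <= size h.
Proof.
rewrite -[leqRHS]muln1 -[in leqRHS](card_ord (size h)) -sum_nat_const.
by apply: leq_sum => j _; apply: leq_b1.
Qed.

Lemma moves_rcons h r i :
  moves (rcons h r) i = moves h i + (sigma h i != sigma (rcons h r) i).
Proof.
rewrite /moves size_rcons big_ord_recr /= -cats1 take_size_cat //.
rewrite [take (size h).+1 _]take_oversize ?size_cat ?addn1 //.
by congr (_ + _); apply: eq_bigr => j _; rewrite !takel_cat // ltnW.
Qed.

(** Truncating to [take t h] freezes the stacks after [t] turns, when a stack may be down to one
    pebble and unable to move. *)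
Definition stack_strategy (h : seq T) : config T :=
  let h' := take t h in stacks (sigma h') (fun i => 2 ^ (t - moves h' i)).

Lemma stack_strategyP : cop_strategy (pebbling_turn e) stack_strategy.
Proof.
move=> h r; rewrite /stack_strategy.
have [le_th | lt_ht] := leqP t (size h).
  by rewrite -cats1 takel_cat //; apply: pebbling_turn_refl.
rewrite !take_oversize ?size_rcons //; last exact: ltnW.
apply: stacks_turn => [|i]; first exact: sigmaP.
(* Halving lowers the exponent by one, which requires [moves h i < t]; this holds as fewer than [t]
   turns have passed. *)
rewrite moves_rcons; case: eqP => _; rewrite ?addn0 // addn1 -expnS -subSn //.
exact: leq_ltn_trans (moves_le h i) lt_ht.
Qed.

Lemma stack_strategy_occ h v :
  size h <= t -> cops_occ (sigma h) v -> pebbling_occ (stack_strategy h) v.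
Proof.
move=> le_ht; rewrite /stack_strategy take_oversize //.
by apply: stacks_occ => i; rewrite expn_gt0.
Qed.

Lemma stack_strategy_size : config_size (stack_strategy [::]) = k * 2 ^ t.
Proof.
rewrite stacks_size -[k in RHS]card_ord -sum_nat_const.
by apply: eq_bigr => i _; rewrite /moves big_ord0 subn0.
Qed.

(** The replayed robber is caught by [sigma] at some turn [n <= t]. Up to then no truncation occurs
    and every cop's vertex carries a nonempty stack, so the original robber is caught at the same
    turn. *)
Lemma stack_strategy_captures :
  captures_within e (@cops_occ T k) t sigma ->
  captures e (@pebbling_occ T) stack_strategy.
Proof.
move=> sigma_wins rho rhoP.
have [n le_nt capt] := sigma_wins _ (replay_strategy stack_strategy rhoP).
exists n; move: capt; rewrite /captured_at !robber_at_replay /cop_at play_replay.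
have occ := @stack_strategy_occ (play stack_strategy rho n).2 _.
rewrite size_play2 in occ.
by case/orP=> [/andP[-> /(occ _ le_nt)->] // | /(occ _ le_nt)->]; rewrite orbT.
Qed.

End PebblingStrategy.

Lemma cop_pebbling_number_le (T : finType) (e : rel T) k t :
  cops_win_within e k t -> cop_pebbling_number e <= k * 2 ^ t.
Proof.
case=> sigma sigmaP sigma_wins; rewrite /cop_pebbling_number.
case: ex_minnP => n _; apply; apply/asboolP.
exists (stack_strategy t sigma [::]); first exact: stack_strategy_size.
exists (stack_strategy t sigma); split=> //; first exact: stack_strategyP.
exact: stack_strategy_captures.
Qed.

Theorem theorem8 (T : finType) (e : rel T)
    (e_sym : symmetric e) (e_irr : irreflexive e) :
  (forall t : nat, cop_number e = 1 -> capture_time e 1 t ->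
     cop_pebbling_number e <= 2 ^ t) /\
  (forall k t : nat, cop_number e = k -> capture_time e k t ->
     cop_pebbling_number e <= k * 2 ^ t).
Proof.
split=> [t _ [win _] | k t _ [win _]]; last exact: cop_pebbling_number_le.
by rewrite -[2 ^ t]mul1n; apply: cop_pebbling_number_le.
Qed.
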